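(* Let $M$ be a prime and let $q$ be a power of $M$. Then, as formal power series in $u$, $$1+\sum_{n=1}^{\infty}c(n,q,M)\,u^n=\prod_{d\geq 1}\left(\prod_{k\geq 1}\frac{1+u^{d(kM-1)}+u^{d(kM-2)}+\cdots+u^{d(kM-(M-1))}}{1-u^{dkM}}\right)^{N(q,d)}.$$
   Context: $\mathrm{GL}(n,q)$ is the group of invertible $n\times n$ matrices over the field $\mathbb F_q$ with $q$ elements. $c(n,q,M)$ is the number of conjugacy classes of $\mathrm{GL}(n,q)$ contained in the image of the power map $x\mapsto x^M$ on $\mathrm{GL}(n,q)$. $N(q,d)$ is the number of monic irreducible polynomials of degree $d$ over $\mathbb F_q$ other than the polynomial $x$. *)

(* Defs.v *)
From HB Require Import structures.
From mathcomp Require Import all_boot all_order all_algebra all_fingroup qpoly.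
From mathcomp Require Import boolp classical_sets.

Set Implicit Arguments.
Unset Strict Implicit.
Unset Printing Implicit Defensive.

Import GRing.Theory.
Local Open Scope ring_scope.

Record fps (R : Type) := FPS { coefs :> nat -> R }.

HB.instance Definition _ (R : Type) := gen_eqMixin (fps R).
HB.instance Definition _ (R : Type) := gen_choiceMixin (fps R).

Lemma fpsP (R : Type) (f g : fps R) : (forall n, f n = g n) -> f = g.
Proof. by case: f g => [f] [g] /= fg; congr FPS; apply/funext. Qed.

Section FpsZmodule.
Variable V : zmodType.
Implicit Types f g h : fps V.

Definition fps_zero : fps V := FPS (fun=> 0).
Definition fps_opp f : fps V := FPS (fun n => - f n).
Definition fps_add f g : fps V := FPS (fun n => f n + g n).

Fact fps_addA : associative fps_add.
Proof. by move=> f g h; apply: fpsP => n; apply: addrA. Qed.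
Fact fps_addC : commutative fps_add.
Proof. by move=> f g; apply: fpsP => n; apply: addrC. Qed.
Fact fps_add0 : left_id fps_zero fps_add.
Proof. by move=> f; apply: fpsP => n; apply: add0r. Qed.
Fact fps_addN : left_inverse fps_zero fps_opp fps_add.
Proof. by move=> f; apply: fpsP => n; apply: addNr. Qed.

HB.instance Definition _ :=
  GRing.isZmodule.Build (fps V) fps_addA fps_addC fps_add0 fps_addN.

Lemma coefs0 n : (0 : fps V) n = 0. Proof. by []. Qed.
Lemma coefsD f g n : (f + g) n = f n + g n. Proof. by []. Qed.
Lemma coefsN f n : (- f) n = - f n. Proof. by []. Qed.
Lemma coefsB f g n : (f - g) n = f n - g n. Proof. by []. Qed.

Lemma coefs_sum (I : Type) (r : seq I) (P : pred I) (F : I -> fps V) n :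
  (\sum_(i <- r | P i) F i) n = \sum_(i <- r | P i) F i n.
Proof. by elim/big_rec2: _ => //= i _ f _ <-. Qed.

End FpsZmodule.

Section FpsRing.
Variable R : comNzRingType.
Implicit Types f g h : fps R.

Definition fps_one : fps R := FPS (fun n => (n == 0%N)%:R).
Definition fps_mul f g : fps R :=
  FPS (fun n => \sum_(i < n.+1) f i * g (n - i)%N).

Definition fps_trunc n f : {poly R} := \poly_(i < n.+1) f i.

Lemma coef_fps_trunc n f i : (i <= n)%N -> (fps_trunc n f)`_i = f i.
Proof. by move=> lein; rewrite coef_poly ltnS lein. Qed.

Lemma fps_mulE n f g i : (i <= n)%N ->
  fps_mul f g i = (fps_trunc n f * fps_trunc n g)`_i.
Proof.
move=> lein; rewrite coefM; apply: eq_bigr => j _.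
by rewrite !coef_fps_trunc // (leq_trans _ lein) ?leq_subr // -ltnS.
Qed.

Fact fps_mulC : commutative fps_mul.
Proof. by move=> f g; apply: fpsP => n; rewrite !(@fps_mulE n) // mulrC. Qed.

Fact fps_mulA : associative fps_mul.
Proof.
move=> f g h; apply: fpsP => n.
transitivity ((fps_trunc n f * (fps_trunc n g * fps_trunc n h))`_n).
  rewrite coefM; apply: eq_bigr => j _.
  by rewrite coef_fps_trunc -1?ltnS // -fps_mulE ?leq_subr.
rewrite mulrA coefM; apply: eq_bigr => j _.
by rewrite -fps_mulE -1?ltnS // coef_fps_trunc ?leq_subr.
Qed.

Fact fps_mul1 : left_id fps_one fps_mul.
Proof.
move=> f; apply: fpsP => n /=.
by rewrite big_ord_recl /= mul1r subn0 big1 ?addr0 // => i _; rewrite mul0r.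
Qed.

Fact fps_mulDl : left_distributive fps_mul +%R.
Proof.
move=> f g h; apply: fpsP => n.
by rewrite coefsD /= -big_split; apply: eq_bigr => i _; rewrite mulrDl.
Qed.

Fact fps_one_neq0 : fps_one != 0.
Proof.
by apply/eqP => /(congr1 (fun f : fps R => f 0%N)) /eqP; rewrite oner_eq0.
Qed.

HB.instance Definition _ := GRing.Zmodule_isComNzRing.Build (fps R)
  fps_mulA fps_mulC fps_mul1 fps_mulDl fps_one_neq0.

Lemma coefs1 n : (1 : fps R) n = (n == 0%N)%:R. Proof. by []. Qed.

Lemma coefsM f g n : (f * g) n = \sum_(i < n.+1) f i * g (n - i)%N.
Proof. by []. Qed.

Lemma coefsM0 f g : (f * g) 0%N = f 0%N * g 0%N.
Proof. by rewrite coefsM big_ord_recl big_ord0 addr0. Qed.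

Lemma coefsX_small f k n : f 0%N = 0 -> (n < k)%N -> (f ^+ k) n = 0.
Proof.
move=> f0; elim: k n => // k IHk n; rewrite ltnS => lenk.
rewrite exprS coefsM big_ord_recl f0 mul0r add0r big1 // => i _.
rewrite IHk ?mulr0 //= /bump /= add1n.
by apply: leq_trans lenk; rewrite ltn_subrL (leq_ltn_trans _ (ltn_ord i)).
Qed.

Definition fpsC (a : R) : fps R := FPS (fun n => a *+ (n == 0%N)).
Definition fpsX : fps R := FPS (fun n => (n == 1%N)%:R).

Lemma coefs_fpsCM a f n : (fpsC a * f) n = a * f n.
Proof.
by rewrite coefsM big_ord_recl /= subn0 big1 ?addr0 // => i _; rewrite mul0r.
Qed.

Lemma coefs_fpsXn k n : (fpsX ^+ k) n = (n == k)%:R.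
Proof.
elim: k n => [|k IHk] [|n] //; rewrite exprS coefsM big_ord_recl /= mul0r add0r.
  by rewrite big_ord0.
rewrite big_ord_recl /= mul1r IHk subn1 eqSS big1 ?addr0 // => i _.
by rewrite mul0r.
Qed.

End FpsRing.

Section FpsUnitRing.
Variable R : comUnitRingType.
Implicit Types f g : fps R.

Definition fps_unit : {pred fps R} := fun f => f 0%N \is a GRing.unit.

(* With a = f_0 a unit, 1/f = a^-1 * \sum_k (1 - a^-1 f)^k; only the terms with
   k <= n contribute to the coefficient of u^n. *)
Definition fps_inv f : fps R :=
  if fps_unit f then
    FPS (fun n =>
      (f 0%N)^-1 * (\sum_(k < n.+1) (1 - fpsC (f 0%N)^-1 * f) ^+ k) n)
  else f.

Fact fps_mulVx : {in fps_unit, left_inverse 1 fps_inv *%R}.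
Proof.
move=> f fU; rewrite mulrC; apply: fpsP => n.
have {}fU : f 0%N \is a GRing.unit by [].
set h := 1 - fpsC (f 0%N)^-1 * f.
have h0 : h 0%N = 0 by rewrite coefsB coefs_fpsCM coefs1 mulVr ?subrr.
pose S := \sum_(k < n.+1) h ^+ k.
have invE i : (i <= n)%N -> fps_inv f i = (fpsC (f 0%N)^-1 * S) i.
  move=> lein; rewrite coefs_fpsCM /fps_inv /fps_unit fU /= -/h.
  congr (_ * _); rewrite /S !coefs_sum (big_ord_widen n.+1 (fun k => (h ^+ k) i)) //.
  rewrite [RHS](bigID (fun k : 'I_n.+1 => (k < i.+1)%N)) /= [X in _ + X]big1 ?addr0 //.
  by move=> k; rewrite -leqNgt => ltik; rewrite coefsX_small.
transitivity ((f * (fpsC (f 0%N)^-1 * S)) n).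
  by rewrite !coefsM; apply: eq_bigr => i _; rewrite invE ?leq_subr.
have -> : f * (fpsC (f 0%N)^-1 * S) = 1 - h ^+ n.+1.
  rewrite mulrA [f * _]mulrC -[X in X * S](subKr 1) -/h.
  by rewrite -opprB mulNr -subrX1 opprB.
by rewrite coefsB coefsX_small // subr0.
Qed.

Fact fps_unitPl f g : g * f = 1 -> fps_unit f.
Proof.
move=> /(congr1 (fun h : fps R => h 0%N)); rewrite coefsM0 coefs1 /= => gf1.
by apply/unitrPr; exists (g 0%N); rewrite mulrC.
Qed.

Fact fps_inv_out : {in [predC fps_unit], fps_inv =1 id}.
Proof.
by move=> f; rewrite inE /= /in_mem /= /fps_inv => /negPf fN; rewrite fN.
Qed.

HB.instance Definition _ := GRing.ComNzRing_hasMulInverse.Build (fps R)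
  fps_mulVx fps_unitPl fps_inv_out.

Lemma fps_unitE f : (f \is a GRing.unit) = (f 0%N \is a GRing.unit).
Proof. by []. Qed.

End FpsUnitRing.

Section InfiniteProduct.
Variable R : comNzRingType.

(* Convergence in the u-adic topology: every coefficient is eventually
   constant. *)
Definition fps_cvg (f : nat -> fps R) (l : fps R) :=
  forall n, exists K, forall k, (K <= k)%N -> f k n = l n.

Definition is_fps_iprod (F : nat -> fps R) (l : fps R) :=
  fps_cvg (fun K => \prod_(1 <= k < K) F k) l.

(* The product over k >= 1 when it converges, and 0 when it does not; a product
   equal to a nonzero series therefore converges. *)
Definition fps_iprod (F : nat -> fps R) : fps R :=
  xget 0 [set l | is_fps_iprod F l]%classic.

Lemma fps_cvg_unique (f : nat -> fps R) l l' :
  fps_cvg f l -> fps_cvg f l' -> l = l'.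
Proof.
move=> fl fl'; apply: fpsP => n; have [K fK] := fl n; have [K' fK'] := fl' n.
by rewrite -(fK (maxn K K')) ?leq_maxl // fK' ?leq_maxr.
Qed.

Lemma fps_iprodE (F : nat -> fps R) l : is_fps_iprod F l -> fps_iprod F = l.
Proof.
move=> Fl; apply: (@fps_cvg_unique (fun K => \prod_(1 <= k < K) F k)) => //.
by apply: (@xgetPex _ 0 [set l | is_fps_iprod F l]%classic); exists l.
Qed.

End InfiniteProduct.

Notation "\iprod_ ( k >= 1 ) F" := (fps_iprod (fun k : nat => F))
  (at level 36, k name, F at level 36,
   format "\iprod_ ( k  >=  1 )  F") : ring_scope.

(* Only meaningful for n >= 1: the library's 'GL_0[F] is 'GL_1[F]. *)
Definition num_power_classes (F : finFieldType) (n M : nat) : nat :=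
  #|[set C in classes 'GL_n[F] |
      C \subset [set (x ^+ M)%g | x in 'GL_n[F]%g]]|.

Definition num_irreducible (F : finFieldType) (d : nat) : nat :=
  #|[set p : {poly_d.+1 F} | [&& (p : {poly F}) \is monic,
      size p == d.+1, irreducibleb p & (p : {poly F}) != 'X]]|.

(* Main.v *)
Require Import Defs.
From HB Require Import structures.
From mathcomp Require Import all_boot all_order all_algebra all_fingroup.
From mathcomp Require Import qpoly finfield ring zify.

Set Implicit Arguments.
Unset Strict Implicit.
Unset Printing Implicit Defensive.

Import GRing.Theory.
Local Open Scope ring_scope.

(** Let [p = M] be the characteristic.  A conjugacy class of GL(n, q) amounts to
    a finite multiset of pairs [(phi, k)], where [phi] is a monic irreducible
    polynomial other than [X] and [k > 0]: the module over [F[X]] defined by a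
    matrix [A] is the direct sum of the modules [F[X] / (phi ^ k)].  This
    multiset is read off the numbers [ker_card A (phi ^+ j)] of vectors killed
    by [phi(A) ^ j], because the exponent of [q ^ deg phi] in that number is the
    sum of [min(k, j)] over the pairs [(phi, k)]; [mxsim_ker_card] says that
    these numbers decide similarity.

    The power map is transparent on these numbers.  If [phi'] is [phi] with its
    coefficients raised to the [p]-th power, then [phi'(X ^ p) = phi(X) ^ p],
    hence [phi'(A ^ p) ^ j = phi(A) ^ (p * j)] ([ker_card_frob]).  Since
    [phi |-> phi'] permutes the irreducible polynomials, the class of [A ^ p] is
    given by the values at the multiples of [p] of the functions
    [j |-> sum of min(k, j)] of [A].  Two classes have the same image exactly
    when they agree at the multiples of [p], so the classes in the image can be
    counted by choosing one representative for each sampled function.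

    Such a representative exists and is unique if one requires that, for each
    [phi] and [k >= 0], at most one part lies strictly between [k p] and
    [(k + 1) p], whereas the multiplicity of the part [(k + 1) p] is free.
    Uniqueness is [data_profile_inj]: the increments of the sampled function,
    divided by [p] with remainder, give back the parts.  Existence is
    [balanced_exists]: two successive increments are separated by a multiple
    of [p], so that the multiplicities computed from quotients and remainders
    are not negative.  This gives a bijection ([num_power_classesE]) between the
    classes in the image and the choices, for each [phi] of degree [d] and each
    [k >= 1], of a multiplicity [c] for the part [k p] and of at most one part
    [k p - j] with [0 < j < p].  A choice adds [d k p c], and [d (k p - j)] if
    the extra part is present, to the dimension, so the generating function is
    the announced product: the numerators record the extra parts and the
    geometric series [1 / (1 - u ^ (d k p))] record the multiplicities.  Only
    the factors with [d <= n] and [k <= n] influence the coefficient of [u ^ n],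
    which reduces the infinite products to finite ones
    ([coef_iprod_factor]). *)

(** * Evaluation at a matrix and similarity *)

Section Eval.
Variable F : fieldType.

(** [horner_mx] needs a dimension of the form [n.+1], while sums of blocks
    naturally start from the empty matrix; [mxeval] agrees with it and makes
    sense in every dimension. *)
Definition mxeval n (A : 'M[F]_n) (p : {poly F}) : 'M[F]_n :=
  \sum_(i < size p) p`_i *: A ^+ i.

Lemma mxeval_horner n (A : 'M[F]_n.+1) p : mxeval A p = horner_mx A p.
Proof.
rewrite -[p in RHS]coefK poly_def linear_sum; apply: eq_bigr => i _.
by rewrite linearZ /= rmorphXn /= horner_mx_X.
Qed.

Lemma mxevalD n (A : 'M[F]_n) p q : mxeval A (p + q) = mxeval A p + mxeval A q.
Proof.
case: n A => [|n] A; first by rewrite [LHS]flatmx0 [RHS]flatmx0.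
by rewrite !mxeval_horner rmorphD.
Qed.

Lemma mxevalM n (A : 'M[F]_n) p q : mxeval A (p * q) = mxeval A p *m mxeval A q.
Proof.
case: n A => [|n] A; first by rewrite [LHS]flatmx0 [RHS]flatmx0.
by rewrite !mxeval_horner rmorphM.
Qed.

Lemma mxevalXn n (A : 'M[F]_n) p k : mxeval A (p ^+ k) = mxeval A p ^+ k.
Proof.
case: n A => [|n] A; first by rewrite [LHS]flatmx0 [RHS]flatmx0.
by rewrite !mxeval_horner rmorphXn.
Qed.

Lemma mxeval0 n (A : 'M[F]_n) : mxeval A 0 = 0.
Proof. by rewrite /mxeval size_poly0 big_ord0. Qed.

Lemma mxeval1 n (A : 'M[F]_n) : mxeval A 1 = 1%:M.
Proof. by rewrite /mxeval size_poly1 big_ord1 coef1 scale1r expr0. Qed.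

Lemma mxevalX n (A : 'M[F]_n) : mxeval A 'X = A.
Proof.
case: n A => [|n] A; first by rewrite [LHS]flatmx0 [RHS]flatmx0.
by rewrite mxeval_horner horner_mx_X.
Qed.

Lemma mxevalZ n (A : 'M[F]_n) c p : mxeval A (c *: p) = c *: mxeval A p.
Proof.
case: n A => [|n] A; first by rewrite [LHS]flatmx0 [RHS]flatmx0.
by rewrite !mxeval_horner linearZ.
Qed.

Lemma mxeval_comp n (A : 'M[F]_n) p k :
  mxeval A (p \Po 'X^k) = mxeval (A ^+ k) p.
Proof.
case: n A => [|n] A; first by rewrite [LHS]flatmx0 [RHS]flatmx0.
rewrite !mxeval_horner comp_polyE rmorph_sum /= -mxeval_horner;
  apply: eq_bigr => i _.
by rewrite linearZ /= !rmorphXn /= horner_mx_X.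
Qed.

Lemma mxeval_intertwine m n (A : 'M[F]_m) (B : 'M[F]_n) (P : 'M[F]_(m, n)) p :
  A *m P = P *m B -> mxeval A p *m P = P *m mxeval B p.
Proof.
move=> AP; rewrite mulmx_suml mulmx_sumr; apply: eq_bigr => i _.
rewrite -scalemxAl -scalemxAr; congr (_ *: _).
elim: (val i) => [|k IHk]; first by rewrite !expr0 mul1mx mulmx1.
by rewrite !exprSr -[_ * A]/(_ *m A) -[_ * B]/(_ *m B) -mulmxA AP mulmxA IHk
  mulmxA.
Qed.

(** Similarity is stated with a rectangular pair of mutually inverse matrices so
    that no cast is needed between dimensions that are only provably equal. *)
Definition mxsim m n (A : 'M[F]_m) (B : 'M[F]_n) :=
  exists P : 'M[F]_(m, n), exists Q : 'M[F]_(n, m),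
    [/\ P *m Q = 1%:M, Q *m P = 1%:M & A *m P = P *m B].

Lemma mxsim_refl n (A : 'M[F]_n) : mxsim A A.
Proof. by exists 1%:M, 1%:M; rewrite !mulmx1 mul1mx. Qed.

Lemma mxsim_sym m n (A : 'M[F]_m) (B : 'M[F]_n) : mxsim A B -> mxsim B A.
Proof.
case=> P [Q [PQ QP AP]]; exists Q, P; split=> //.
by rewrite -[RHS]mulmx1 -PQ !mulmxA -[Q *m A *m P]mulmxA AP mulmxA QP mul1mx.
Qed.

Lemma mxsim_trans m n r (B : 'M[F]_n) (A : 'M[F]_m) (C : 'M[F]_r) :
  mxsim A B -> mxsim B C -> mxsim A C.
Proof.
case=> P [Q [PQ QP AP]] [P' [Q' [PQ' QP' BP]]].
exists (P *m P'), (Q' *m Q); split.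
- by rewrite mulmxA -[P *m _ *m _]mulmxA PQ' mulmx1.
- by rewrite mulmxA -[Q' *m _ *m _]mulmxA QP mulmx1.
- by rewrite mulmxA AP -!mulmxA BP.
Qed.

Lemma mxsim_dim m n (A : 'M[F]_m) (B : 'M[F]_n) : mxsim A B -> m = n.
Proof.
case=> P [Q [PQ QP _]]; apply/eqP; rewrite eqn_leq.
rewrite -{1}(mxrank1 F m) -PQ (leq_trans (mxrankM_maxl _ _)) ?rank_leq_col //=.
by rewrite -{1}(mxrank1 F n) -QP (leq_trans (mxrankM_maxl _ _)) ?rank_leq_col.
Qed.

Lemma mxsim_exp m n (A : 'M[F]_m) (B : 'M[F]_n) k :
  mxsim A B -> mxsim (A ^+ k) (B ^+ k).
Proof.
case=> P [Q [PQ QP AP]]; exists P, Q; split=> //.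
by have := mxeval_intertwine 'X^k AP; rewrite !mxevalXn !mxevalX.
Qed.

Lemma mxsim_square n (A B : 'M[F]_n) :
  mxsim A B -> exists2 P, P \in unitmx & A = P *m B *m invmx P.
Proof.
case=> P [Q [PQ QP AP]]; have [Pu _] := mulmx1_unit PQ.
by exists P; rewrite // -AP mulmxK.
Qed.

Definition dsum_mx m n (A : 'M[F]_m) (B : 'M[F]_n) : 'M[F]_(m + n) :=
  block_mx A 0 0 B.

Lemma mxsim_dsum m n m' n' (A : 'M[F]_m) (B : 'M[F]_n) (A' : 'M[F]_m')
  (B' : 'M[F]_n') :
  mxsim A A' -> mxsim B B' -> mxsim (dsum_mx A B) (dsum_mx A' B').
Proof.
case=> P [Q [PQ QP AP]] [P' [Q' [PQ' QP' BP]]].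
exists (block_mx P 0 0 P'), (block_mx Q 0 0 Q').
rewrite /dsum_mx !mulmx_block !(mul0mx, mulmx0, addr0, add0r) PQ QP PQ' QP' AP
  BP.
by split=> //; rewrite -scalar_mx_block.
Qed.

Lemma mxsim_dsumC m n (A : 'M[F]_m) (B : 'M[F]_n) :
  mxsim (dsum_mx A B) (dsum_mx B A).
Proof.
exists (block_mx 0 1%:M 1%:M 0), (block_mx 0 1%:M 1%:M 0).
rewrite /dsum_mx !mulmx_block !(mul0mx, mulmx0, mul1mx, mulmx1, addr0, add0r).
by split; rewrite -?scalar_mx_block.
Qed.

Lemma mxsim_dsumA m n r (A : 'M[F]_m) (B : 'M[F]_n) (C : 'M[F]_r) :
  mxsim (dsum_mx A (dsum_mx B C)) (dsum_mx (dsum_mx A B) C).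
Proof.
exists (block_mx (row_mx 1%:M 0) 0 (block_mx 0 1%:M 0 0) (col_mx 0 1%:M)).
exists (block_mx (col_mx 1%:M 0) (block_mx 0 0 1%:M 0) 0 (row_mx 0 1%:M)).
rewrite /dsum_mx; split.
- rewrite mulmx_block mul_row_col !mulmx_block mul_mx_row mul_row_block.
  rewrite !(mul0mx, mulmx0, mul1mx, mulmx1, addr0, add0r).
  rewrite mul_block_col mul_col_row !(mul0mx, mulmx0, mul1mx, mulmx1, addr0,
    add0r).
  by rewrite add_block_mx row_mx0 col_mx0 !(addr0, add0r) -!scalar_mx_block.
- rewrite mulmx_block mul_col_row !mulmx_block mul_block_col mul_row_block.
  rewrite mul_row_col !(mul0mx, mulmx0, mul1mx, mulmx1, addr0, add0r).
  by rewrite add_block_mx col_mx0 row_mx0 !(addr0, add0r) -!scalar_mx_block.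
- rewrite !mulmx_block !(mul0mx, mulmx0, mul1mx, mulmx1, addr0, add0r).
  rewrite mul_mx_row mul_row_block mul_block_col mul_col_mx.
  by rewrite !(mul0mx, mulmx0, mul1mx, mulmx1, addr0, add0r).
Qed.

(** Both inclusions of the summands intertwine the actions, so it is enough to
    stack the two instances of [mxeval_intertwine]. *)
Lemma mxeval_dsum m n (A : 'M[F]_m) (B : 'M[F]_n) p :
  mxeval (dsum_mx A B) p = dsum_mx (mxeval A p) (mxeval B p).
Proof.
have inA : A *m row_mx 1%:M 0 = row_mx 1%:M 0 *m dsum_mx A B.
  by rewrite mul_mx_row mul_row_block !(mul0mx, mulmx0, mul1mx, mulmx1, addr0).
have inB : B *m row_mx 0 1%:M = row_mx 0 1%:M *m dsum_mx A B.
  by rewrite mul_mx_row mul_row_block !(mul0mx, mulmx0, mul1mx, mulmx1, add0r).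
have := congr2 col_mx (mxeval_intertwine p inA) (mxeval_intertwine p inB).
rewrite -mul_col_mx -[col_mx (row_mx _ _) _]/(block_mx 1%:M 0 0 1%:M).
rewrite -scalar_mx_block mul1mx => <-.
by rewrite !mul_mx_row !(mulmx0, mulmx1).
Qed.

End Eval.

(** * Cyclic modules and kernel sizes *)

Section Quot.
Variable F : finFieldType.
Implicit Types p h a phi : {poly F}.

Lemma exists_irreducible_dvd p : (1 < size p)%N ->
  exists phi : {poly F}, [/\ irreducible_poly phi, phi \is monic & phi %| p].
Proof.
have [k] := ubnP (size p); elim: k p => // k IHk p sp p1.
have p0 : p != 0 by rewrite -size_poly_gt0 ltnW.
have [/irreducibleP irr|] := boolP (irreducibleb p).
  have l0 : (lead_coef p)^-1 != 0 by rewrite invr_eq0 lead_coef_eq0.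
  exists ((lead_coef p)^-1 *: p); split; last by rewrite dvdpZl.
    split=> [|q q1]; first by rewrite size_scale.
    by rewrite dvdpZr // => /(irr.2 _ q1) /eqp_trans-> //;
      rewrite eqp_sym eqp_scale.
  by rewrite monicE lead_coefZ mulVf // lead_coef_eq0.
rewrite /irreducibleb p1 negb_forall => /existsP[q]; rewrite negb_imply -ltnNge.
rewrite -Pdiv.Idomain.dvdpE => /andP[dqp q1].
have sq : (size q < size p)%N.
  by rewrite (leq_ltn_trans (size_npoly q)) // prednK // ltnW.
have [phi [irr mon dphi]] := IHk q (leq_trans sq sp) q1.
by exists phi; split=> //; exact: dvdp_trans dqp.
Qed.

Lemma factor_irreducible phi a : irreducible_poly phi -> a != 0 ->
  exists l, exists2 a' : {poly F}, a = phi ^+ l * a' & coprimep phi a'.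
Proof.
move=> irr; have [k] := ubnP (size a); elim: k a => // k IHk a sa a0.
have [dphi|] := boolP (phi %| a); last first.
  by rewrite -irreducible_poly_coprime // => cop; exists 0%N, a; rewrite ?mul1r.
have [b ab] := dvdpP _ _ dphi.
have b0 : b != 0 by apply: contra_neq a0 => b0; rewrite ab b0 mul0r.
have sb : (size b < k)%N.
  rewrite -ltnS; apply: leq_trans sa; rewrite ab size_mul ?(irredp_neq0 irr) //.
  by have := irr.1; case: (size phi) => [|[|n]] // _;
    rewrite !addnS /= !ltnS leq_addr.
have [l [b' bb' cop]] := IHk b sb b0.
by exists l.+1, b' => //; rewrite ab bb' mulrC mulrA exprS.
Qed.

(** The module [F[X] / (p)]: residues are encoded by row vectors of
    coefficients, on which [X] acts by multiplication followed by reduction. *)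
Definition quotX_mx p : 'M[F]_((size p).-1) :=
  lin1_mx (fun v => poly_rV (('X * rVpoly v) %% p)).

Lemma ltn_size_rVpoly p (v : 'rV[F]_(size p).-1) :
  p != 0 -> (size (rVpoly v) < size p)%N.
Proof.
move=> p0; apply: (@leq_ltn_trans (size p).-1); first exact: size_poly.
by rewrite prednK // size_poly_gt0.
Qed.

Lemma rVpoly_quotX p v : p != 0 ->
  rVpoly (v *m quotX_mx p) = ('X * rVpoly v) %% p.
Proof.
move=> p0; pose f (v : 'rV[F]_(size p).-1) := ('X * rVpoly v) %% p.
have lf : linear (poly_rV \o f : 'rV_((size p).-1) -> 'rV_(size p).-1).
  move=> a u w /=; rewrite /f linearP /= mulrDr -scalerAr modpD modpZl.
  exact: linearP.
pose fL := GRing.isLinear.Build _ _ _ _ _ lf.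
pose g : {linear _ -> _} := HB.pack (poly_rV \o f : 'rV_((size p).-1) ->
  'rV_(size p).-1) fL.
rewrite -[quotX_mx p]/(lin1_mx g) mul_rV_lin1 /= poly_rV_K //.
by rewrite -ltnS prednK ?ltn_modp // lt0n size_poly_eq0.
Qed.

Lemma rVpoly_mxeval_quotX p h v : p != 0 ->
  rVpoly (v *m mxeval (quotX_mx p) h) = (h * rVpoly v) %% p.
Proof.
move=> p0; elim/poly_ind: h v => [|h c IHh] v.
  by rewrite mxeval0 mulmx0 linear0 mul0r mod0p.
rewrite mxevalD mxevalM mxevalX -[c%:P]mulr1 mul_polyC mxevalZ mxeval1 mulmxDr
  mulmxA.
rewrite -scalemxAr mulmx1 linearD linearZ /= rVpoly_quotX // IHh modp_mul.
rewrite mulrDl -scalerAl mul1r modpD modpZl (modp_small (ltn_size_rVpoly v p0)).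
by congr (_ %% _ + _); rewrite mulrA [_ * h]mulrC.
Qed.

(** Over a finite field the size of a kernel carries the same information as its
    dimension; it is invariant under similarity and multiplicative on direct
    sums. *)
Definition ker_card n (A : 'M[F]_n) h :=
  #|[set v : 'rV[F]_n | v *m mxeval A h == 0]|.

Lemma ker_card_mxsim m n (A : 'M[F]_m) (B : 'M[F]_n) h :
  mxsim A B -> ker_card A h = ker_card B h.
Proof.
case=> P [Q [PQ QP AP]].
have Pinj : injective (fun v : 'rV[F]_m => v *m P).
  by apply: (can_inj (g := mulmxr Q)) => v /=; rewrite -mulmxA PQ mulmx1.
rewrite /ker_card -(card_imset _ Pinj); apply: eq_card => v; rewrite inE.
have E := mxeval_intertwine h AP.
apply/imsetP/eqP => [[w]|v0]; first rewrite inE => /eqP w0 ->.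
  by rewrite -mulmxA -E mulmxA w0 mul0mx.
exists (v *m Q); last by rewrite -mulmxA QP mulmx1.
rewrite inE -[_ *m mxeval _ _]mulmx1 -PQ mulmxA -[_ *m P]mulmxA E !mulmxA.
by rewrite -[v *m Q *m P]mulmxA QP mulmx1 v0 mul0mx.
Qed.

Lemma ker_card_dsum m n (A : 'M[F]_m) (B : 'M[F]_n) h :
  ker_card (dsum_mx A B) h = (ker_card A h * ker_card B h)%N.
Proof.
pose f (vw : 'rV[F]_m * 'rV[F]_n) := row_mx vw.1 vw.2.
have finj : injective f by move=> [v w] [v' w'] /eq_row_mx/= [-> ->].
rewrite -cardsX -(card_imset _ finj) /ker_card; apply: eq_card => v.
rewrite inE -[v]hsubmxK mxeval_dsum mul_row_block !mulmx0 addr0 add0r.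
rewrite row_mx_eq0.
apply/idP/imsetP => [v0|[[w w'] + /eq_row_mx[-> ->]]].
  by exists (lsubmx v, rsubmx v); rewrite // !inE /= v0.
by rewrite !inE.
Qed.

(** With [g] the gcd and [p = p' g], a residue [a] is killed by [h] iff [p']
    divides it, hence iff [a = p' b] for some [b] of degree less than
    [deg g]. *)
Lemma ker_card_quotX p h : p != 0 ->
  ker_card (quotX_mx p) h = (#|F| ^ (size (gcdp p h)).-1)%N.
Proof.
move=> p0; set g := gcdp p h.
have g0 : g != 0 by rewrite gcdp_eq0 (negPf p0).
have gp : p = p %/ g * g by rewrite divpK ?dvdp_gcdl.
have gh : h = h %/ g * g by rewrite divpK ?dvdp_gcdr.
have cop : coprimep (p %/ g) (h %/ g) by rewrite coprimep_div_gcd ?p0.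
move: gp gh cop; set p' := p %/ g; set h' := h %/ g => gp gh cop.
have p'0 : p' != 0 by apply: contra_neq p0 => p'0; rewrite gp p'0 mul0r.
have sp : (size p).-1 = ((size p').-1 + (size g).-1)%N.
  rewrite gp size_mul //; move: p'0 g0; rewrite -!size_poly_gt0.
  by move: (size p') (size g) => [|a] [|b] // _ _; rewrite addSn /= addnS.
rewrite -card_npoly.
pose f (b : {poly_((size g).-1) F}) : 'rV[F]_((size p).-1) := poly_rV (p' * b).
have fK b : rVpoly (f b) = p' * b.
  rewrite poly_rV_K // sp (leq_trans (size_polyMleq _ _)) //.
  have := size_npoly b; move: p'0; rewrite -size_poly_gt0.
  by move: (size p') => [|x] // _ sb; rewrite addSn /= leq_add2l.
have finj : injective f.
  by move=> b b' /(congr1 rVpoly); rewrite !fK => /(mulfI p'0)/val_inj.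
rewrite -(card_imset _ finj); apply: eq_card => v; rewrite inE.
have -> : (v *m mxeval (quotX_mx p) h == 0) = (p' %| rVpoly v).
  rewrite -(can_eq rVpolyK) linear0 rVpoly_mxeval_quotX // -/(p %| _).
  move: (rVpoly v) => a; rewrite {1}gp gh.
  by rewrite mulrAC dvdp_mul2r // Gauss_dvdpr.
apply/idP/imsetP => [/dvdpP[b vb]|[b _ ->]]; last by rewrite fK dvdp_mulr.
have bs : b \is a poly_of_size (size g).-1.
  have [->|b0] := eqVneq b 0; first by rewrite qualifE /= size_poly0.
  have := ltn_size_rVpoly v p0; rewrite vb size_mul // qualifE /=.
  move: sp p'0 g0 b0; rewrite -!size_poly_gt0.
  move: (size p') (size g) (size b) (size p) => [|x] [|y] [|z] [|t] //=.
  by rewrite ?addnS /= => -> _ _ _; rewrite ltnS [(x + y)%N]addnC ltn_add2r.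
exists (NPoly bs) => //; apply: (can_inj rVpolyK).
by rewrite fK vb mulrC.
Qed.

End Quot.

(** * Splitting off a cyclic summand *)

Section Split.
Variable F : finFieldType.
Implicit Types p h a phi : {poly F}.

Lemma mxeval_rVpoly m n (A : 'M[F]_n) (w : 'rV[F]_m) :
  mxeval A (rVpoly w) = \sum_(i < m) w 0 i *: A ^+ i.
Proof.
rewrite /rVpoly poly_def (big_morph _ (mxevalD A) (mxeval0 A));
  apply: eq_bigr => i _.
by rewrite valK mxevalZ mxevalXn mxevalX.
Qed.

Lemma eq_mul_rV m n (A B : 'M[F]_(m, n)) :
  (forall w : 'rV_m, w *m A = w *m B) -> A = B.
Proof. by move=> AB; apply/row_matrixP => i; rewrite !rowE. Qed.

Lemma mxeval_modl n (A : 'M[F]_n) p a (v : 'rV[F]_n) :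
  v *m mxeval A p = 0 -> v *m mxeval A (a %% p) = v *m mxeval A a.
Proof.
move=> vp; rewrite [in RHS](divp_eq a p) mxevalD [_ * p]mulrC mxevalM mulmxDr
  mulmxA.
by rewrite vp mul0mx add0r.
Qed.

Lemma mxeval_modr n (A : 'M[F]_n) p a (f : 'cV[F]_n) :
  mxeval A p *m f = 0 -> mxeval A (a %% p) *m f = mxeval A a *m f.
Proof.
move=> fp; rewrite [in RHS](divp_eq a p) mxevalD mxevalM mulmxDl -mulmxA.
by rewrite fp mulmx0 add0r.
Qed.

Lemma mxsim_row_split m r n (A : 'M[F]_n) (C : 'M[F]_m) (B : 'M[F]_r)
  (T : 'M[F]_(m + r, n)) :
  row_free T -> row_full T -> dsum_mx C B *m T = T *m A ->
    mxsim A (dsum_mx C B).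
Proof.
move=> fr fl E; apply: mxsim_sym; exists T, (pinvmx T); split=> //.
  exact: mulmxVp.
exact: mulVpmx.
Qed.

(** The rows [v A^i] span a copy of [F[X] / (p)], and the vectors orthogonal to
    all the columns [A^j f] form an invariant subspace. The hypothesis says that
    the bilinear form [(a, b) |-> v (a b)(A) f] is nondegenerate on
    [F[X] / (p)]; this makes the two subspaces complementary. *)
Lemma split_cyclic n (A : 'M[F]_n) p (v : 'rV[F]_n) (f : 'cV[F]_n) :
    p != 0 -> v *m mxeval A p = 0 -> mxeval A p *m f = 0 ->
    (forall a, ~~ (p %| a) -> exists b, v *m mxeval A (a * b) *m f != 0) ->
  exists r, exists B : 'M[F]_r, mxsim A (dsum_mx (quotX_mx p) B).
Proof.
move=> p0 vp fp nondeg; set m := (size p).-1.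
pose P : 'M[F]_(m, n) := \matrix_(i < m) (v *m A ^+ i).
pose Q : 'M[F]_(n, m) := \matrix_(i < n, j < m) (A ^+ j *m f) i 0.
have wP (w : 'rV_m) : w *m P = v *m mxeval A (rVpoly w).
  rewrite mulmx_sum_row mxeval_rVpoly mulmx_sumr; apply: eq_bigr => i _.
  by rewrite rowK scalemxAr.
have Qw (w : 'rV_m) : Q *m w^T = mxeval A (rVpoly w) *m f.
  apply/colP => i; rewrite mxE mxeval_rVpoly mulmx_suml summxE.
  by apply: eq_bigr => j _; rewrite -scalemxAl !mxE mulrC.
have PA : quotX_mx p *m P = P *m A.
  apply: eq_mul_rV => w; rewrite !mulmxA !wP rVpoly_quotX // mxeval_modl //.
  by rewrite mulrC mxevalM mxevalX mulmxA.
have AQ : A *m Q = Q *m (quotX_mx p)^T.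
  apply: trmx_inj; apply: eq_mul_rV => w; apply: trmx_inj.
  rewrite !trmx_mul !trmxK -!mulmxA Qw -trmx_mul Qw rVpoly_quotX //
    mxeval_modr //.
  by rewrite mxevalM mxevalX mulmxA.
have PQfree : row_free (P *m Q).
  rewrite -kermx_eq0; apply/rowV0P => w /sub_kermxP wPQ.
  apply/eqP; apply: contraT => w0.
  have a0 : rVpoly w != 0 by rewrite -(can_eq rVpolyK) linear0 in w0 *.
  have [|b] := nondeg (rVpoly w).
    by rewrite gtNdvdp // ltn_size_rVpoly.
  case/eqP; rewrite mxevalM mulmxA -mulmxA -(mxeval_modr b fp) mulmxA -mulmxA
    -wP.
  rewrite -(@poly_rV_K _ m (b %% p)); last first.
    by rewrite -ltnS prednK ?ltn_modp // size_poly_gt0.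
  by rewrite -Qw -!mulmxA [P *m _]mulmxA mulmxA wPQ mul0mx.
have Qfree : row_full Q.
  rewrite /row_full eqn_leq rank_leq_col /=.
  by move: PQfree; rewrite /row_free => /eqP {1}<-; exact: mxrankM_maxr.
(* The complement is the left kernel of Q; it is introduced abstractly so that
   its dimension does not unfold during rewriting. *)
have [r [K [KE Kfree rE]]] : exists r, exists K : 'M[F]_(r, n),
    [/\ (K :=: kermx Q)%MS, row_free K & r = \rank (kermx Q)].
  exists (\rank (kermx Q)), (row_base (kermx Q)).
  by split=> //; [exact: eq_row_base | exact: row_base_free].
have KQ : K *m Q = 0 by apply/sub_kermxP; rewrite KE.
have KA : (K *m A <= K)%MS.
  by rewrite KE; apply/sub_kermxP; rewrite -mulmxA AQ mulmxA KQ mul0mx.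
exists r, (K *m A *m pinvmx K).
have Tfree : row_free (col_mx P K).
  rewrite -kermx_eq0; apply/rowV0P => w /sub_kermxP.
  rewrite -[w]hsubmxK mul_row_col => w0.
  have wl0 : lsubmx w = 0.
    move/(congr1 (mulmx^~ Q)): w0; rewrite mulmxDl -!mulmxA KQ mulmx0 addr0
      mul0mx.
    by move/eqP; rewrite mulmx_free_eq0 // => /eqP.
  move: w0; rewrite wl0 mul0mx add0r => /eqP.
  by rewrite mulmx_free_eq0 // => /eqP->; rewrite row_mx0.
apply: (@mxsim_row_split _ _ _ _ _ _ (col_mx P K)) => //.
  rewrite /row_full; move: (Tfree); rewrite /row_free => /eqP->.
  rewrite rE mxrank_ker; move: Qfree; rewrite /row_full => /eqP E.
  by rewrite E subnKC // -E rank_leq_row.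
by rewrite mul_block_col !mul0mx addr0 add0r PA mulmxKpV // mul_col_mx.
Qed.

(** Write the minimal polynomial as [phi ^ k * g] with [g] prime to [phi]. The
    matrix [g(A)^2 phi(A)^(k-1)] is nonzero, so has a nonzero entry [(i, j)].
    Take for [v] the row [i] of [g(A)] and for [f] its column [j]: both are
    killed by [phi(A)^k], and every nonzero residue modulo [phi ^ k] has a
    multiple congruent to [phi ^ (k - 1)], on which the form of [split_cyclic]
    does not vanish. *)
Lemma split_primary n (A : 'M[F]_n.+1) :
  exists phi k, [/\ irreducible_poly phi, phi \is monic, (0 < k)%N &
    exists r, exists B : 'M[F]_r, mxsim A (dsum_mx (quotX_mx (phi ^+ k)) B)].
Proof.
have mu1 : (1 < size (mxminpoly A))%N.
  by rewrite size_mxminpoly ltnS mxminpoly_nonconstant.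
have [phi [irr mon dphi]] := exists_irreducible_dvd mu1.
have mu0 : mxminpoly A != 0 by rewrite -size_poly_gt0 ltnW.
have [k [g muE cop]] := factor_irreducible irr mu0.
have k0 : (0 < k)%N.
  case: k muE => // muE; move: cop.
  by rewrite irreducible_poly_coprime // -[g]mul1r -(expr0 phi) -muE dphi.
exists phi, k; split=> //.
have phik0 : phi ^+ k != 0 by rewrite expf_neq0 ?(irredp_neq0 irr).
have N0 : mxeval A (g * phi ^+ k.-1 * g) != 0.
  rewrite mxeval_horner -dvd_mxminpoly muE.
  apply/negP => /(dvdp_trans (dvdp_mulr _ (dvdpp _))).
  rewrite mulrAC Gauss_dvdpr ?coprimepMr ?coprimep_expl // ?cop //.
  rewrite dvdp_Pexp2l; first by rewrite -[X in (X <= _)%N]prednK // ltnn.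
  exact: irr.1.
have [i [j Nij]] := matrix0Pn _ N0.
have muA : mxeval A (g * phi ^+ k) = 0.
  by rewrite mulrC -muE mxeval_horner mx_root_minpoly.
pose v : 'rV_n.+1 := delta_mx 0 i *m mxeval A g.
pose f : 'cV_n.+1 := mxeval A g *m delta_mx j 0.
have vp : v *m mxeval A (phi ^+ k) = 0 by rewrite -mulmxA -mxevalM muA mulmx0.
apply: (@split_cyclic _ _ _ v f) => //.
- by rewrite mulmxA -mxevalM mulrC muA mul0mx.
move=> a phia.
have a0 : a != 0 by apply: contraNneq phia => ->; rewrite dvdp0.
have [l [a' aE cop']] := factor_irreducible irr a0.
have lk : (l < k)%N.
  rewrite ltnNge; apply: contra phia => kl.
  by rewrite aE dvdp_mulr // dvdp_exp2l.
have [[x y] /= xy] : exists u, u.1 * phi ^+ k + u.2 * a' = 1.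
  by apply/Bezout_eq1_coprimepP; rewrite coprimep_expl.
(* Up to a multiple of phi ^ k, this cofactor turns a = phi ^ l * a' into
   phi ^ (k - 1), by the Bezout relation between phi ^ k and a'. *)
exists (y * phi ^+ (k.-1 - l)).
have -> : a * (y * phi ^+ (k.-1 - l)) =
  phi ^+ k.-1 - phi ^+ k * (x * phi ^+ k.-1).
  have ll : (l <= k.-1)%N by rewrite -ltnS prednK.
  have ya : y * a' = 1 - x * phi ^+ k by rewrite -xy addrC addKr.
  have pk : phi ^+ k.-1 = phi ^+ l * phi ^+ (k.-1 - l) by rewrite -exprD subnKC.
  transitivity ((y * a') * (phi ^+ l * phi ^+ (k.-1 - l))).
    by rewrite aE; ring.
  by rewrite -pk ya; ring.
apply: contra_neq Nij => E.
have {}E : v *m mxeval A (phi ^+ k.-1) *m f = 0.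
  move: E; rewrite -mulrN mxevalD mxevalM mulmxDr [v *m (_ *m _)]mulmxA.
  by rewrite vp mul0mx addr0.
have -> (C : 'M[F]_n.+1) : C i j =
    ((delta_mx 0 i : 'rV_n.+1) *m C *m (delta_mx j 0 : 'cV_n.+1)) 0 0.
  by rewrite -rowE -colE !mxE.
by rewrite !mxevalM !mulmxA; move: E; rewrite /v /f !mulmxA => ->; rewrite mxE.
Qed.

End Split.

(** * Primary decomposition and similarity invariants *)

Section Blocks.
Variable F : finFieldType.
Implicit Types (p h a phi psi : {poly F}) (x y : {poly F} * nat)
  (s t : seq ({poly F} * nat)).

(** A list of pairs [(phi, k)] stands for the direct sum of the modules
    [F[X] / (phi ^ k)]. *)
Fixpoint primary_dim s : nat :=
  if s is x :: s' then (size (x.1 ^+ x.2)).-1 + primary_dim s' else 0%N.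
Fixpoint primary_mx s : 'M[F]_(primary_dim s) :=
  if s is x :: s' return 'M[F]_(primary_dim s) then
    dsum_mx (quotX_mx (x.1 ^+ x.2)) (primary_mx s')
  else 0.

Definition prime_poly phi := irreducibleb phi && (phi \is monic).
Definition primary_block x := prime_poly x.1 && (0 < x.2)%N.
(** The exponent of [#|F| ^ deg phi] in the size of the kernel of [phi ^+ j];
    see [ker_card_primary]. *)
Definition block_profile s phi j := (\sum_(x <- s | x.1 == phi) minn x.2 j)%N.

Lemma prime_poly_size phi : prime_poly phi -> (1 < size phi)%N.
Proof. by case/andP=> /irreducibleP[]. Qed.

Lemma prime_poly_neq0 phi : prime_poly phi -> phi != 0.
Proof. by move/prime_poly_size=> phi1; rewrite -size_poly_gt0 ltnW. Qed.

Lemma prime_poly_eq phi psi : prime_poly phi -> prime_poly psi ->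
  phi %| psi -> phi = psi.
Proof.
move=> phiP /andP[/irreducibleP irr mon] dv; apply/eqP.
rewrite -eqp_monic //; last by case/andP: phiP.
by apply: irr.2 dv; rewrite neq_ltn (prime_poly_size phiP) orbT.
Qed.

Lemma size_gcd_prime_exp phi psi k j : prime_poly phi -> prime_poly psi ->
  (size (gcdp (psi ^+ k) (phi ^+ j))).-1 =
  if psi == phi then ((size phi).-1 * minn k j)%N else 0%N.
Proof.
move=> Pphi Ppsi; have [->|neq] := eqVneq.
  by rewrite (eqp_size (gcdp_exp _ _ _)) size_exp.
have cop : coprimep psi phi.
  have/andP[/irreducibleP irr _] := Ppsi.
  rewrite irreducible_poly_coprime //; apply: contra neq => dv.
  by apply/eqP/prime_poly_eq.
have : coprimep (psi ^+ k) (phi ^+ j) by rewrite coprimep_expl ?coprimep_expr.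
by rewrite /coprimep => /eqP->.
Qed.

Lemma exists_primary_mx n (A : 'M[F]_n) :
  exists2 s, all primary_block s & mxsim A (primary_mx s).
Proof.
have [k] := ubnP n; elim: k n A => // k IHk [|n] A nk.
  by exists [::] => //; rewrite [A]flatmx0; exact: mxsim_refl.
have [phi [e [irr mon e0 [r [B sAB]]]]] := split_primary A.
have rk : (r < k)%N.
  have := mxsim_dim sAB; rewrite size_exp.
  have : (0 < (size phi).-1 * e)%N by rewrite muln_gt0 -ltnS e0 prednK ?irr.1 //
    ltnW ?irr.1.
  move: nk; rewrite /=; move: (_ * e)%N => d nk d0 En; lia.
have [s gs sBs] := IHk _ B rk.
exists ((phi, e) :: s).
  by rewrite /= gs andbT /primary_block /prime_poly mon e0 !andbT;
    apply/irreducibleP.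
exact: mxsim_trans sAB (mxsim_dsum (mxsim_refl _) sBs).
Qed.

Lemma ker_card_primary s phi j : all primary_block s -> prime_poly phi ->
  ker_card (primary_mx s) (phi ^+ j) =
    (#|F| ^ ((size phi).-1 * block_profile s phi j))%N.
Proof.
move=> + Pphi; elim: s => [|x s IHs] /=.
  move=> _; rewrite /block_profile big_nil muln0 expn0 /ker_card.
  rewrite (eq_card (B := predT)) ?card_mx // => v.
  by rewrite !inE [v]thinmx0 mul0mx eqxx.
case/andP=> /andP[Px x0] gs; rewrite ker_card_dsum IHs // ker_card_quotX.
  rewrite size_gcd_prime_exp // -expnD /block_profile big_cons.
  by case: eqP => //; rewrite mulnDr.
by rewrite expf_neq0 // prime_poly_neq0.
Qed.

Lemma mxsim_primary_rem s x : x \in s ->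
  mxsim (primary_mx s) (primary_mx (x :: rem x s)).
Proof.
elim: s => // y s IHs; rewrite inE /=.
have [->|neq] /= := eqVneq y x; first by move=> _; exact: mxsim_refl.
move=> /IHs sx.
apply: mxsim_trans (mxsim_dsum (mxsim_refl _) sx) _.
apply: mxsim_trans (mxsim_dsumA _ _ _) _.
apply: mxsim_trans (mxsim_dsum (mxsim_dsumC _ _) (mxsim_refl _)) _.
exact: mxsim_sym (mxsim_dsumA _ _ _).
Qed.

Lemma mxsim_primary_perm s t : perm_eq s t ->
  mxsim (primary_mx s) (primary_mx t).
Proof.
elim: s t => [|x s IHs] t st.
  by move: st; rewrite perm_sym => /perm_nilP->; exact: mxsim_refl.
have xt : x \in t by rewrite -(perm_mem st) mem_head.
apply: mxsim_trans (mxsim_sym (mxsim_primary_rem xt)).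
apply: mxsim_dsum (mxsim_refl _) (IHs _ _).
by rewrite -(perm_cons x) (perm_trans st) // perm_to_rem.
Qed.

(** A part is detected by the second difference of [j |-> min(k, j)], which
    vanishes except at [k]. *)
Lemma count_block_profile s phi k :
  (block_profile s phi k.+1 + block_profile s phi k.+1 =
   block_profile s phi k + block_profile s phi k.+2 +
   count_mem (phi, k.+1) s)%N.
Proof.
rewrite /block_profile; elim: s => [|[psi e] s IHs]; first by rewrite !big_nil.
rewrite !big_cons /= xpair_eqE; have [_|_] /= := eqVneq psi phi => //.
move: IHs; set a := bigop _ _ _; set b := bigop _ _ _; set c := bigop _ _ _.
move: a b c (count_mem _ s) => a b c d IH.
by case: (eqVneq e k.+1) => [->|ne] /=; lia.
Qed.

Lemma perm_eq_profile s t : all primary_block s -> all primary_block t ->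
  (forall phi j, prime_poly phi ->
    block_profile s phi j = block_profile t phi j) ->
  perm_eq s t.
Proof.
move=> gs gt st; apply/allP => -[phi k] xst; apply/eqP.
have : primary_block (phi, k).
  by move: xst; rewrite mem_cat => /orP[/(allP gs)|/(allP gt)].
case: k {xst} => [|k] /andP[//= Pphi _].
have := count_block_profile s phi k;
  rewrite !(st phi) // count_block_profile => /eqP.
by rewrite eqn_add2l => /eqP.
Qed.

(** Both matrices are sums of primary blocks, and the kernel sizes determine the
    lists of blocks up to order. *)
Lemma mxsim_ker_card m n (A : 'M[F]_m) (B : 'M[F]_n) :
  (forall phi j, prime_poly phi ->
    ker_card A (phi ^+ j) = ker_card B (phi ^+ j)) ->
  mxsim A B.
Proof.
move=> AB; have [s gs As] := exists_primary_mx A;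
  have [t gt Bt] := exists_primary_mx B.
apply: (mxsim_trans As); apply: (mxsim_trans _ (mxsim_sym Bt));
  apply/mxsim_primary_perm/perm_eq_profile => //.
move=> phi j Pphi; have := AB phi j Pphi.
rewrite (ker_card_mxsim _ As) (ker_card_mxsim _ Bt) !ker_card_primary //
  => /eqP.
have phi1 := prime_poly_size Pphi.
rewrite eqn_exp2l ?card_finNzRing_gt1 // eqn_pmul2l; first by move/eqP.
by case: (size phi) phi1 => [|[|]].
Qed.

Section Frobenius.
Variables (M : nat) (charM : M \in [pchar F]).
Let frob := map_poly (pFrobenius_aut charM).

(** Raising to the power [M] is a ring morphism in characteristic [M]. *)
Lemma frob_comp phi : frob phi \Po 'X^M = phi ^+ M.
Proof.
have charP : M \in [pchar {poly F}] by rewrite pchar_poly.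
elim/poly_ind: phi => [|phi c IH].
  by rewrite /frob rmorph0 comp_poly0 expr0n; case: M (pcharf_prime charM).
rewrite /frob rmorphD rmorphM /= map_polyX map_polyC /= comp_polyD comp_polyM.
rewrite comp_polyX comp_polyC -/frob IH -[RHS](pFrobenius_autE charP).
by rewrite rmorphD rmorphM /= !pFrobenius_autE polyC_exp.
Qed.

Lemma ker_card_frob n (A : 'M[F]_n) phi j :
  ker_card (A ^+ M) (frob phi ^+ j) = ker_card A (phi ^+ (M * j)).
Proof. by rewrite /ker_card -mxeval_comp rmorphXn /= frob_comp -exprM. Qed.

(** An injective endomorphism of a finite field is onto, so the coefficients can
    be changed to their [M]-th roots; irreducibility is reflected because the
    coefficientwise Frobenius preserves divisibility. *)
Lemma frob_surj phi : prime_poly phi ->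
  exists2 psi, prime_poly psi & frob psi = phi.
Proof.
move=> Pphi.
pose f : {rmorphism F -> F} := pFrobenius_aut charM.
have finj : injective f := fmorph_inj f.
have f0 : invF finj 0 = 0 by rewrite -{1}(rmorph0 f) invF_f.
have psiE : frob (map_poly (invF finj) phi) = phi.
  apply/polyP => i; rewrite /frob coef_map /= coef_map_id0 //.
  exact: f_invF.
exists (map_poly (invF finj) phi) => //.
move: psiE; set psi := map_poly _ phi => psiE.
case/andP: Pphi => /irreducibleP irr mon; apply/andP; split.
  apply/irreducibleP; split=> [|q q1 dq].
    by rewrite -(size_map_poly f) -/frob psiE irr.1.
  rewrite -(eqp_map f) -/frob psiE; apply: irr.2;
    first by rewrite size_map_poly.
  by rewrite -psiE dvdp_map.
by rewrite -(map_monic f) -[map_poly _ _]/(frob psi) psiE.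
Qed.

End Frobenius.
End Blocks.
Arguments primary_block {F} x.

(** * Partitions sampled at the multiples of M *)

Section Balanced.
Local Open Scope nat_scope.
Variables (M : nat) (M_gt0 : 0 < M).
Implicit Types (b c : nat -> nat) (l : seq nat).

(** The function [j |-> sum of min(x, j)] of the partition that has, for each
    [k < n], [c k] parts [(k + 1) M] and one part [k M + b k] if [b k != 0]. *)
Definition data_profile n b c j :=
  \sum_(k < n) (c k * minn (k.+1 * M) j +
                (if b k == 0 then 0 else minn (k * M + b k) j)).
(** The quotient by [M] of the increment of [data_profile] between [i M] and
    [(i + 1) M]: each part larger than [(i + 1) M], or equal to it, contributes
    [M] to that increment, and the part [i M + b i] contributes the
    remainder. *)
Definition data_level n b c i :=
  \sum_(k < n) ((i <= k) * c k + ((i < k) && (b k != 0))).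

Lemma sum_delta n i (f : nat -> nat) :
  \sum_(k < n) (k == i :> nat) * f k = (i < n) * f i.
Proof.
have [lt_in|le_ni] := ltnP i n; last first.
  rewrite big1 // => k _; case: eqP => // ki.
  by have := ltn_ord k; rewrite ki ltnNge le_ni.
rewrite (bigD1 (Ordinal lt_in)) //= eqxx big1 ?addn0 // => k ki.
by rewrite -val_eqE /= in ki; rewrite (negPf ki).
Qed.

Lemma data_level_rec n b c i :
  data_level n b c i =
  data_level n b c i.+1 + (i < n) * c i + (i.+1 < n) * (b i.+1 != 0).
Proof.
rewrite -(sum_delta n i c) -(sum_delta n i.+1 (fun k => b k != 0 : nat))
  -!big_split /=.
apply: eq_bigr => k _.
case: (b k != 0); rewrite ?(andbT, andbF, muln1, muln0);
 move: (c k) => ck; case: (ltngtP i k) => ik /=; lia.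
Qed.

Lemma data_level_big n b c i : n <= i -> data_level n b c i = 0.
Proof.
move=> ni; rewrite /data_level big1 // => k _; have := ltn_ord k => kn.
by rewrite leqNgt (leq_trans kn ni) ltnNge ltnW ?(leq_trans kn ni).
Qed.

Lemma data_profile_step n b c i : (forall k, b k < M) ->
  data_profile n b c (i.+1 * M) =
  data_profile n b c (i * M) + (i < n) * b i + M * data_level n b c i.
Proof.
move=> bM; rewrite -(sum_delta n i b) big_distrr -!big_split /=.
apply: eq_bigr => k _; have := bM k; move: (b k) (c k) => bk ck bkM.
case: (ltngtP i k) => ik /=.
- have h1 : i.+1 * M <= k * M by rewrite leq_mul2r ik orbT.
  have -> : minn (k.+1 * M) (i.+1 * M) = i * M + M by lia.
  have -> : minn (k.+1 * M) (i * M) = i * M by lia.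
  by case: eqP => [->|bk0] /=; nia.
- have h1 : k.+1 * M <= i * M by rewrite leq_mul2r ik orbT.
  have -> : minn (k.+1 * M) (i.+1 * M) = k.+1 * M by lia.
  have -> : minn (k.+1 * M) (i * M) = k.+1 * M by lia.
  by case: eqP => [->|bk0] /=; nia.
- rewrite -ik.
  have -> : minn (i.+1 * M) (i.+1 * M) = i * M + M by lia.
  have -> : minn (i.+1 * M) (i * M) = i * M by lia.
  by case: eqP => [->|bk0] /=; nia.
Qed.

Lemma data_profile0 n b c : data_profile n b c 0 = 0.
Proof.
by rewrite /data_profile big1 // => k _; rewrite !minn0 muln0; case: ifP.
Qed.

(** The remainder and the quotient of an increment by [M] give [b i] and
    [data_level i]; the successive differences of the latter give [c]. *)
Lemma data_profile_inj n b c b' c' : (forall k, b k < M) ->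
  (forall k, b' k < M) ->
  (forall i, data_profile n b c (i * M) = data_profile n b' c' (i * M)) ->
  forall k, k < n -> b k = b' k /\ c k = c' k.
Proof.
move=> bM bM' EE.
have step i : (i < n) * b i + M * data_level n b c i =
  (i < n) * b' i + M * data_level n b' c' i.
  by have := EE i.+1; rewrite !data_profile_step // (EE i) -!addnA => /addnI.
have bb i : i < n -> b i = b' i.
  move=> iN; have := congr1 (modn^~ M) (step i).
  by rewrite iN !mul1n ![M * _]mulnC ![_ + _ * M]addnC !modnMDl !modn_small.
have TT i : data_level n b c i = data_level n b' c' i.
  have := step i; have [/bb->|_] := ltnP i n; first move/addnI.
    by move/eqP; rewrite eqn_pmul2l // => /eqP.
  by rewrite !mul0n !add0n => /eqP; rewrite eqn_pmul2l // => /eqP.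
move=> k kn; split; first exact: bb.
have := data_level_rec n b c k; rewrite TT data_level_rec TT kn.
case: (ltnP k.+1 n) => [/bb->|_]; lia.
Qed.

Definition part_profile l j := \sum_(x <- l) minn x j.

Lemma part_profile_mono l i :
  part_profile l (i * M) <= part_profile l (i.+1 * M).
Proof. by apply: leq_sum => x _; rewrite mulSn; lia. Qed.

Lemma part_profile_le l j : part_profile l j <= sumn l.
Proof. by rewrite sumnE; apply: leq_sum => x _; apply: geq_minl. Qed.

(** A part [x] counts for [M] in the [i]-th increment if [x >= (i + 1) M], and
    for 0 in the next one if [x <= (i + 1) M], and for at most [M] otherwise;
    thus [M] times the number of parts that are at least [(i + 1) M] separates
    the two increments. *)
Lemma part_profile_balance l i (t := count (leq (i.+1 * M)) l) :
  part_profile l (i.+2 * M) - part_profile l (i.+1 * M) <= t * M <=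
  part_profile l (i.+1 * M) - part_profile l (i * M).
Proof.
rewrite leq_subLR leq_subRL ?part_profile_mono //.
rewrite {}/t -sum1_count big_distrl /= !big_mkcond /= /part_profile -!big_split
  /=.
apply/andP; split; apply: leq_sum => x _; rewrite !mulSn; move: (i * M) => z;
  case: ifP => /=; lia.
Qed.

(** The parameters are forced by [data_profile_step]: [b] and [a] are the
    remainders and quotients of the increments, and [c] is what [data_level_rec]
    leaves. The subtraction defining [c] is not truncated, by
    [part_profile_balance]. *)
Lemma balanced_exists n l : all (leq^~ n) l ->
  exists b c, [/\ forall k, b k < M, forall k, c k <= sumn l &
    forall i, data_profile n b c (i * M) = part_profile l (i * M)].
Proof.
move=> ln.
pose mu i := part_profile l (i.+1 * M) - part_profile l (i * M).
pose a i := mu i %/ M; pose b i := mu i %% M.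
pose c i := a i - (a i.+1 + (b i.+1 != 0)).
(* With t M between the two increments, a (i + 1), rounded up when there is a
   remainder, is at most t, and t is at most a i. *)
have key i : a i.+1 + (b i.+1 != 0) <= a i.
  have /andP[] := part_profile_balance l i; rewrite -/(mu i) -/(mu i.+1).
  move: (count _ l) => t h1 h2.
  have ta : t <= a i by rewrite leq_divRL.
  apply: leq_trans ta; have := divn_eq (mu i.+1) M;
    rewrite -/(a i.+1) -/(b i.+1).
  by case: eqP => [->|b0] E /=; rewrite E in h1; nia.
have mu0 i : n <= i -> mu i = 0.
  move=> ni; apply/eqP; rewrite subn_eq0; apply: eq_leq;
    apply: eq_big_seq => x xl.
  have xn : x <= n := allP ln x xl.
  by have : i <= i * M by [rewrite leq_pmulr]; rewrite mulSn; lia.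
have bM k : b k < M by rewrite ltn_mod.
have TT i : data_level n b c i = a i.
  have [ni|] := leqP n i; first by rewrite data_level_big // /a mu0 ?div0n.
  move=> lin; have [d] : exists d, i + d = n by exists (n - i); lia.
  elim: d i {lin} => [|d IHd] i din.
    by rewrite data_level_big /a ?mu0 ?div0n //; lia.
  rewrite data_level_rec IHd; last by lia.
  have -> : i < n by lia.
  have := key i; rewrite /c; have [_|ni] := ltnP i.+1 n; first by lia.
  by rewrite /b mu0 // mod0n /=; lia.
exists b, c; split=> //.
  move=> k; apply: leq_trans (leq_subr _ _) _.
  apply: leq_trans (leq_div _ _) _; apply: leq_trans (leq_subr _ _)
    (part_profile_le _ _).
elim=> [|i IHi]; first by rewrite !mul0n data_profile0 /part_profile big1 //
  => x _; rewrite minn0.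
rewrite data_profile_step // IHi TT.
have -> : (i < n) * b i = b i.
  by have [_|ni] := ltnP i n; rewrite ?mul1n // /b mu0 // mod0n.
have := divn_eq (mu i) M; rewrite -/(a i) -/(b i) /mu;
  have := part_profile_mono l i; lia.
Qed.

End Balanced.

(** * Generating function of the choices *)

Section Trunc.
Variable R : comNzRingType.
Implicit Types f g : fps R.

Definition eq_upto n f g := forall i, (i <= n)%N -> f i = g i.

Lemma eq_upto_refl n f : eq_upto n f f. Proof. by []. Qed.

Lemma eq_upto_trans n f g h : eq_upto n f g -> eq_upto n g h -> eq_upto n f h.
Proof. by move=> fg gh i iN; rewrite fg ?gh. Qed.

Lemma eq_uptoM n f g f' g' : eq_upto n f g -> eq_upto n f' g' ->
  eq_upto n (f * f') (g * g').
Proof.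
move=> fg fg' i iN; rewrite !coefsM; apply: eq_bigr => j _.
by rewrite fg ?fg' // (leq_trans _ iN) ?leq_subr // -ltnS.
Qed.

Lemma eq_upto_prod n (I : Type) (r : seq I) (P : pred I) (F G : I -> fps R) :
  (forall i, P i -> eq_upto n (F i) (G i)) ->
  eq_upto n (\prod_(i <- r | P i) F i) (\prod_(i <- r | P i) G i).
Proof.
move=> FG; apply: (big_ind2 (eq_upto n)) => // *; exact: eq_uptoM.
Qed.

Lemma eq_upto_prod1 n (I : Type) (r : seq I) (P : pred I) (F : I -> fps R) :
  (forall i, P i -> eq_upto n (F i) 1) ->
    eq_upto n (\prod_(i <- r | P i) F i) 1.
Proof.
move=> F1; apply: (big_ind (eq_upto n ^~ 1)) => // f g f1 g1.
by rewrite -[X in eq_upto _ _ X]mulr1; apply: eq_uptoM.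
Qed.

Lemma eq_uptoX n f g k : eq_upto n f g -> eq_upto n (f ^+ k) (g ^+ k).
Proof. by move=> fg; elim: k => // k IHk; rewrite !exprS; apply: eq_uptoM. Qed.

(** When the [k]-th factor is 1 up to [u ^ (k - 1)], the coefficient of [u ^ n]
    in the partial products is constant after [n] factors. *)
Lemma iprod_trunc (F : nat -> fps R) n K :
  (forall k i, (i < k)%N -> F k i = (1 : fps R) i) -> (n < K)%N ->
  eq_upto n (fps_iprod F) (\prod_(1 <= k < K) F k).
Proof.
move=> F1.
have stab m K' : (m < K')%N ->
    eq_upto m (\prod_(1 <= k < K') F k) (\prod_(1 <= k < m.+1) F k).
  move=> mK; rewrite (big_cat_nat (n := m.+1)) //= -[X in eq_upto _ _ X]mulr1.
  apply: eq_uptoM => //; rewrite big_nat;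
    apply: eq_upto_prod1 => k /andP[mk _] i im.
  by rewrite F1 // (leq_ltn_trans im).
pose l : fps R := FPS (fun m => (\prod_(1 <= k < m.+1) F k) m).
have Fl : is_fps_iprod F l.
  by move=> m; exists m.+1 => K' mK; rewrite (stab m K' mK).
move=> nK i iN; rewrite (fps_iprodE Fl) /= (stab i K) //.
exact: leq_ltn_trans nK.
Qed.

End Trunc.

Section Factor.
Variables (M : nat) (M_gt1 : (1 < M)%N).
Let u : fps int := fpsX int.

Definition factor d k : fps int :=
  (1 + \sum_(1 <= j < M) u ^+ (d * (k * M - j))%N) / (1 - u ^+ (d * k * M)%N).

(** The size of the part of a choice that concerns [k]: here [k] starts at 0, so
    the full parts are [(k + 1) M], with multiplicity [bc.2], and the extra part
    is [k M + bc.1], absent when [bc.1 = 0]. A multiplicity larger than [n]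
    cannot occur in total size [n]. *)
Definition weight n k (bc : 'I_M * 'I_n.+1) : nat :=
  (if bc.1 == 0 :> nat then 0 else k * M + bc.1) + bc.2 * (k.+1 * M).

Lemma coef_u k n : (u ^+ k) n = (n == k)%:R.
Proof. exact: coefs_fpsXn. Qed.

Lemma eq_upto_geom n e : (0 < e)%N ->
  eq_upto n (1 - u ^+ e)^-1 (\sum_(c < n.+1) u ^+ (c * e)).
Proof.
move=> e0.
have un : 1 - u ^+ e \is a GRing.unit.
  by rewrite fps_unitE coefsB coefs1 coef_u eqxx; case: e e0.
have geom : (1 - u ^+ e) * (\sum_(c < n.+1) u ^+ (c * e)) = 1 - u ^+ (n.+1 * e).
  under eq_bigr do rewrite mulnC exprM.
  by rewrite -opprB mulNr -subrX1 opprB -exprM mulnC.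
rewrite -[X in eq_upto _ _ X](mulKr un) geom -[X in eq_upto _ X _]mulr1.
apply: eq_uptoM => // i iN; rewrite coefsB coef_u (_ : _ == _ = false) ?subr0
  //.
by apply/eqP; nia.
Qed.

(** The numerator runs over the extra part, via [b = M - j], and the geometric
    series over the multiplicity of the full part. *)
Lemma factor_coef d k n : (0 < d)%N ->
  eq_upto n (factor d k.+1) (\sum_(bc : 'I_M * 'I_n.+1) u ^+ (d * weight k bc)).
Proof.
move=> d0.
have -> : \sum_(bc : 'I_M * 'I_n.+1) u ^+ (d * weight k bc) =
  (\sum_(b < M) u ^+ (d * (if b == 0 :> nat then 0 else k * M + b))) *
  (\sum_(c < n.+1) u ^+ (c * (d * k.+1 * M))).
  rewrite big_distrl /=; under [RHS]eq_bigr do rewrite big_distrr /=.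
  rewrite pair_bigA /=; apply: eq_bigr => -[b c] _ /=.
  by rewrite -exprD /weight mulnDr /=; congr (u ^+ (_ + _)%N); ring.
apply: eq_uptoM; last by apply: eq_upto_geom; rewrite !muln_gt0 d0 (ltnW M_gt1).
set lhs := 1 + _; set rhs := \sum_(b < M) _;
  suff -> : lhs = rhs by exact: eq_upto_refl.
rewrite {}/lhs {}/rhs.
case: M M_gt1 => // m m1; rewrite big_ord_recl /= muln0; congr (1 + _).
(* The numerator lists the exponents k M - j, which are the k' M + b with
   k = k' + 1 and b = M - j, in the opposite order. *)
rewrite big_add1 /= big_mkord (reindex_inj rev_ord_inj) /=.
apply: eq_bigr => j _; congr (u ^+ (d * _)%N); have := ltn_ord j.
by rewrite /bump /= add1n; nia.
Qed.

Lemma weight_gt n k (bc : 'I_M * 'I_n.+1) :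
  (bc.1 != 0 :> nat) || (bc.2 != 0 :> nat) -> (k < weight k bc)%N.
Proof.
rewrite /weight; case: bc => b c /=.
by case: (eqVneq (b : nat) 0%N) => [_|b0] /= c0; nia.
Qed.

Lemma factor_small d k i : (0 < d)%N -> (i < d)%N || (i < k)%N ->
  (0 < k)%N -> factor d k i = (1 : fps int) i.
Proof.
move=> d0; case: k => // k ik _.
rewrite (factor_coef k d0 (leqnn i)) coefs_sum.
pose bc0 : 'I_M * 'I_i.+1 := (Ordinal (ltnW M_gt1), ord0).
rewrite (bigD1 bc0) //= /weight /= muln0 coef_u big1 ?addr0 // => -[b c] bc.
rewrite coef_u; case: eqP => //= iE.
have : (k < weight k (b, c))%N.
  apply: weight_gt; move: bc; rewrite -negb_and xpair_eqE -!val_eqE /=.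
  exact: contra.
by rewrite /weight /=; move: iE ik; nia.
Qed.

Lemma iprod_factor_small d i : (i < d)%N ->
  fps_iprod (factor d) i = (1 : fps int) i.
Proof.
move=> id; have d0 : (0 < d)%N by case: d id.
rewrite (@iprod_trunc _ _ i i.+1) //; last first.
  by move=> k j jk; apply: factor_small; rewrite ?jk ?orbT //; case: k jk.
rewrite big_nat; apply: (@eq_upto_prod1 _ i) => // k /andP[k0 _] j ji.
by apply: factor_small => //; rewrite (leq_ltn_trans ji id).
Qed.

(** Truncate both products, replace the power [N d] by a product over the
    indices of degree [d], expand every factor and distribute: a term of the
    expansion is a choice function [f]. *)
Lemma coef_iprod_factor (I : finType) (deg : I -> nat) (N : nat -> nat) n :
  (forall i, 0 < deg i <= n)%N ->
  (forall d, (0 < d <= n)%N -> N d = #|[pred i | deg i == d]|) ->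
  fps_iprod (fun d => fps_iprod (factor d) ^+ N d) n =
  #|[set f : {ffun I * 'I_n -> 'I_M * 'I_n.+1} |
      (\sum_(x : I * 'I_n) deg x.1 * weight x.2 (f x))%N == n]|%:R.
Proof.
move=> degP NE.
rewrite (@iprod_trunc _ _ n n.+1) //; last first.
  move=> d i id; rewrite (@eq_uptoX _ i _ 1) ?expr1n // => j ji.
  by rewrite iprod_factor_small // (leq_ltn_trans ji).
have -> : \prod_(1 <= d < n.+1) fps_iprod (factor d) ^+ N d =
          \prod_i fps_iprod (factor (deg i)).
  rewrite [RHS](eq_bigr (fun i => \prod_(d <- index_iota 1 n.+1 | d == deg i)
      fps_iprod (factor d))); last first.
    by move=> i _; rewrite -big_filter filter_pred1_uniq ?iota_uniq
      ?mem_index_iota ?ltnS // big_seq1.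
  rewrite (exchange_big_dep xpredT) //= big_nat [RHS]big_nat.
  apply: eq_bigr => d /andP[d0]; rewrite ltnS => dn.
  rewrite prodr_const NE ?d0 //; congr (_ ^+ _).
  by apply: eq_card => i; rewrite !inE eq_sym.
have trunc : eq_upto n (\prod_i fps_iprod (factor (deg i)))
    (\prod_(x : I * 'I_n) \sum_(bc : 'I_M * 'I_n.+1) u ^+
      (deg x.1 * weight x.2 bc)).
  apply: (@eq_upto_trans _ _ _ (\prod_i \prod_(k < n) factor (deg i) k.+1)).
    apply: eq_upto_prod => i _; have /andP[d0 _] := degP i.
    have := @iprod_trunc _ (factor (deg i)) n n.+1; rewrite big_add1 big_mkord.
    apply=> // k j jk; apply: factor_small; rewrite ?jk ?orbT //; by case: k jk.
  rewrite pair_bigA /=; apply: eq_upto_prod => x _; apply: factor_coef.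
  by have /andP[] := degP x.1.
rewrite (trunc n) // bigA_distr_bigA /= coefs_sum.
rewrite -sum1_card natr_sum big_mkcond [RHS]big_mkcond /=;
  apply: eq_bigr => f _.
rewrite inE -(big_morph _ (exprD u) (expr0 u)) coef_u eq_sym.
by case: eqP.
Qed.

End Factor.

(** * Power classes and choices *)

Section GL.
Variables (F : finFieldType) (n' : nat).
Local Notation n := n'.+1.
Implicit Types x y : {'GL_n[F]}.

Lemma GLval_exp x k : GLval (x ^+ k)%g = GLval x ^+ k.
Proof. by elim: k => // k IHk; rewrite expgS GL_ME IHk exprS. Qed.

Lemma mxsim_classP x y :
  mxsim (GLval x) (GLval y) <-> (x ^: 'GL_n[F] = y ^: 'GL_n[F])%g.
Proof.
split=> [/mxsim_square[P Pu xy]|/class_eqP/imsetP[g _ ->]].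
  apply/class_eqP/imsetP; exists (Sub P Pu : {'GL_n[F]})^-1%g;
    first by rewrite inE.
  apply: val_inj; rewrite conjgE invgK; set g : {'GL_n[F]} := Sub P Pu.
  have -> : val (g * (y * g^-1))%g = GLval g * (GLval y * (GLval g)^-1) by [].
  by rewrite mulrA.
exists (GLval g^-1%g), (GLval g); rewrite -!GL_MxE mulgV mulVg; split=> //.
by rewrite conjgE -!mulgA mulgV mulg1.
Qed.

Lemma ker_card_X m (A : 'M[F]_m) :
  (ker_card A ('X ^+ 1) == 1%N) = (A \in unitmx).
Proof.
rewrite -row_free_unit -kermx_eq0 /ker_card expr1 mxevalX.
apply/idP/idP => [/cards1P[w] E | /eqP K].
  apply/rowV0P => v /sub_kermxP v0.
  have in0 (a : 'rV_m) : a *m A = 0 -> a = w.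
    by move=> a0; apply/set1P; rewrite -E inE a0.
  by rewrite (in0 v v0) -(in0 0) ?mul0mx.
apply/cards1P; exists 0; apply/setP => v; rewrite !inE.
apply/eqP/eqP => [v0|->]; last by rewrite mul0mx.
by apply/eqP; rewrite -submx0 -K; apply/sub_kermxP.
Qed.

Lemma exists_GL m (B : 'M[F]_m) : m = n -> B \in unitmx ->
  exists x, mxsim (GLval x) B.
Proof.
move=> mn; rewrite {}mn in B *; move=> Bu.
by exists (Sub B Bu : {'GL_n[F]}); exact: mxsim_refl.
Qed.

Lemma prime_X : prime_poly ('X : {poly F}).
Proof.
rewrite /prime_poly monicX andbT; apply/irreducibleP.
by rewrite -['X]subr0; exact: irredp_XsubC.
Qed.

(** A matrix is invertible iff [X] acts injectively, that is iff no block
    belongs to the irreducible polynomial [X]. *)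
Lemma primary_mx_unit (s : seq ({poly F} * nat)) : all primary_block s ->
  (primary_mx s \in unitmx) = all (fun z => z.1 != 'X) s.
Proof.
move=> gs; rewrite -ker_card_X ker_card_primary ?prime_X // size_polyX mul1n.
rewrite -{2}[1%N](expn0 #|F|) eqn_exp2l ?card_finNzRing_gt1 //.
elim: s gs => [|x s IHs] /=; first by rewrite /block_profile big_nil.
move=> /andP[/andP[_ x0] gs]; rewrite -(IHs gs) /block_profile big_cons.
by case: (x.1 =P 'X) => //= _; rewrite addn_eq0 (minn_idPr x0).
Qed.

Lemma primary_dimE (s : seq ({poly F} * nat)) :
  primary_dim s = (\sum_(x <- s) (size x.1).-1 * x.2)%N.
Proof.
by elim: s => [|x s IHs] /=; rewrite ?big_nil // big_cons IHs size_exp.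
Qed.

End GL.

Section Classes.
Variables (F : finFieldType) (M n' : nat).
Hypothesis charM : M \in [pchar F].
Local Notation n := n'.+1.
Let M_gt1 : (1 < M)%N. Proof. exact: prime_gt1 (pcharf_prime charM). Qed.
Let M_gt0 : (0 < M)%N. Proof. exact: ltnW. Qed.

(** Polynomials of degree at most [n] form a finite type, and no other can occur
    in a matrix of size [n]. *)
Definition prime_index := {phi : {poly_n.+1 F} |
  prime_poly (phi : {poly F}) && ((phi : {poly F}) != 'X)}.
Definition ipoly (i : prime_index) : {poly F} := val i.
Definition ideg (i : prime_index) := (size (ipoly i)).-1.

Lemma ipoly_prime i : prime_poly (ipoly i). Proof. by case/andP: (valP i). Qed.
Lemma ipoly_neqX i : ipoly i != 'X. Proof. by case/andP: (valP i). Qed.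

Lemma ideg_bound i : (0 < ideg i <= n)%N.
Proof.
have := prime_poly_size (ipoly_prime i); have := size_npoly (val i).
by rewrite /ideg /ipoly; case: (size _) => [|[|k]].
Qed.

Lemma ipoly_surj (phi : {poly F}) : prime_poly phi -> phi != 'X ->
  (size phi <= n.+1)%N -> exists i, ipoly i = phi.
Proof.
move=> Pphi phiX sphi; pose p : {poly_n.+1 F} :=
  NPoly (sphi : phi \is a poly_of_size n.+1).
have Pp : prime_poly (p : {poly F}) && ((p : {poly F}) != 'X) by rewrite Pphi.
by exists (exist _ p Pp).
Qed.

Lemma ipoly_inj : injective ipoly.
Proof. by move=> i j ij; apply/val_inj/val_inj. Qed.

Lemma num_irreducibleE d : (0 < d <= n)%N ->
  num_irreducible F d = #|[pred i | ideg i == d]|.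
Proof.
move=> /andP[d0 dn].
have sz i : ideg i == d -> size (ipoly i) = d.+1.
  move/eqP=> <-; rewrite prednK // ltnW //;
    exact: prime_poly_size (ipoly_prime i).
pose f i : {poly_d.+1 F} := npolyp d.+1 (ipoly i).
have fK i : ideg i == d -> f i = ipoly i :> {poly F}.
  by move/sz=> E; rewrite npolypK ?E.
have finj : {in [pred i | ideg i == d] &, injective f}.
  by move=> i j; rewrite !inE => di dj fij; apply: ipoly_inj;
    rewrite -fK // fij fK.
rewrite -(card_in_imset finj) /num_irreducible; apply: eq_card => p.
rewrite !inE; apply/and4P/imsetP => [[mon /eqP sp irrp pX]|[i + ->]].
  have [|||i iE] := @ipoly_surj p; rewrite ?/prime_poly ?mon ?irrp ?sp //.
  have di : ideg i == d by rewrite /ideg iE sp.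
  by exists i; rewrite // ; apply: val_inj; rewrite /= fK.
rewrite inE => di; rewrite fK // (sz i di) eqxx.
by have /andP[-> ->] := ipoly_prime i; rewrite ipoly_neqX.
Qed.

(** The value [(b, c)] at [(phi, k)] stands for [c] parts [(k + 1) M] and, if
    [b != 0], one part [k M + b]. *)
Definition choices := {ffun prime_index * 'I_n -> 'I_M * 'I_n.+1}.

Definition blocks (x : prime_index * 'I_n) (bc : 'I_M * 'I_n.+1) :
  seq ({poly F} * nat) :=
  nseq bc.2 (ipoly x.1, (x.2.+1 * M)%N) ++
  (if bc.1 == 0 :> nat then [::] else [:: (ipoly x.1, (x.2 * M + bc.1)%N)]).

Definition choice_blocks (f : choices) :=
  flatten [seq blocks x (f x) | x : prime_index * 'I_n].

Lemma choice_blocksP f y : y \in choice_blocks f ->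
  primary_block y && (y.1 \in codom ipoly).
Proof.
case/flattenP => _ /mapP[[i k] _ ->]; rewrite mem_cat mem_nseq.
have Pi := ipoly_prime i.
case/orP => [/andP[_ /eqP->]|].
  by rewrite /primary_block /= Pi muln_gt0 M_gt0 codom_f.
case: eqP => // /eqP b0; rewrite inE => /eqP->.
by rewrite /primary_block /= Pi codom_f addn_gt0 [(0 < (f _).1)%N]lt0n b0 orbT.
Qed.

Lemma choice_primary f : all primary_block (choice_blocks f).
Proof. by apply/allP => y /choice_blocksP/andP[]. Qed.

Lemma choice_unit f : primary_mx (choice_blocks f) \in unitmx.
Proof.
rewrite primary_mx_unit ?choice_primary //;
  apply/allP => y /choice_blocksP/andP[_].
by case/codomP => i ->; exact: ipoly_neqX.
Qed.

Lemma big_choice_blocks (f : choices) (P : pred ({poly F} * nat))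
  (G : {poly F} * nat -> nat) :
  (\sum_(y <- choice_blocks f | P y) G y =
   \sum_(x : prime_index * 'I_n) \sum_(y <- blocks x (f x) | P y) G y)%N.
Proof. by rewrite /choice_blocks big_flatten big_map big_enum. Qed.

Lemma dim_choice_blocks f :
  primary_dim (choice_blocks f) =
  (\sum_(x : prime_index * 'I_n) ideg x.1 * weight x.2 (f x))%N.
Proof.
rewrite primary_dimE (big_choice_blocks f xpredT); apply: eq_bigr => -[i k] _.
rewrite /blocks big_cat big_nseq /= iter_addn_0 /weight mulnDr addnC;
  congr (_ + _)%N.
  by case: eqP => _; rewrite ?big_nil ?muln0 // big_seq1.
by rewrite -mulnA; congr (_ * _)%N; rewrite mulnC.
Qed.

Definition rest_of (f : choices) i k : nat := (f (i, inord k)).1.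
Definition full_of (f : choices) i k : nat := (f (i, inord k)).2.

Lemma block_profile_choice f i j :
  block_profile (choice_blocks f) (ipoly i) j =
    data_profile M n (rest_of f i) (full_of f i) j.
Proof.
rewrite /block_profile big_choice_blocks.
pose G i' k := (\sum_(y <- blocks (i', k) (f (i', k)) | y.1 == ipoly i) minn y.2
  j)%N.
transitivity (\sum_x G x.1 x.2)%N; first by apply: eq_bigr => -[].
rewrite -(pair_bigA _ G) {}/G /=.
rewrite (bigD1 i) //= [X in (_ + X)%N]big1 ?addn0 => [|i' i'i].
  apply: eq_bigr => k _; rewrite /rest_of /full_of inord_val /blocks big_cat /=.
  congr (_ + _)%N; first by rewrite big_nseq_cond eqxx iter_addn_0 mulnC.
  by case: eqP => _; rewrite ?big_nil // big_cons big_nil eqxx addn0.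
rewrite big1 // => k _; rewrite big_cat /= big_nseq_cond.
have -> : (ipoly i' == ipoly i) = false by rewrite (inj_eq ipoly_inj)
  (negPf i'i).
by rewrite add0n; case: eqP => _; rewrite ?big_nil //
  big_cons big_nil /= (inj_eq ipoly_inj) (negPf i'i).
Qed.

Lemma block_profile_notin (s : seq ({poly F} * nat)) phi j :
  phi \notin [seq y.1 | y <- s] -> block_profile s phi j = 0%N.
Proof.
move=> phis; rewrite /block_profile big_seq_cond big1 // => y /andP[ys /eqP E].
by case/negP: phis; rewrite -E map_f.
Qed.

Lemma choice_inj (f g : choices) :
  (forall i j, block_profile (choice_blocks f) (ipoly i) (j * M) =
    block_profile (choice_blocks g) (ipoly i) (j * M)) ->
  f = g.
Proof.
move=> fg; apply/ffunP => -[i k].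
have bM (h : choices) m : (rest_of h i m < M)%N by exact: ltn_ord.
have E j : data_profile M n (rest_of f i) (full_of f i) (j * M) =
  data_profile M n (rest_of g i) (full_of g i) (j * M).
  by rewrite -!block_profile_choice.
have [] := data_profile_inj M_gt0 (bM f) (bM g) E (ltn_ord k).
rewrite /rest_of /full_of inord_val.
by case: (f _) (g _) => [b c] [b' c'] /= /val_inj-> /val_inj->.
Qed.

(** Apply [balanced_exists] to the parts attached to each irreducible
    polynomial; all of them, and all multiplicities, are bounded by the
    dimension. *)
Lemma choice_exists (s : seq ({poly F} * nat)) : all primary_block s ->
    all (fun y => y.1 != 'X) s -> primary_dim s = n ->
  exists f : choices, forall phi j, prime_poly phi ->
    block_profile (choice_blocks f) phi (j * M) = block_profile s phi (j * M).
Proof.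
move=> gs sX sn.
have part i : exists bc : (nat -> nat) * (nat -> nat),
    [/\ forall k, (bc.1 k < M)%N, forall k, (bc.2 k <= n)%N &
      forall j, data_profile M n bc.1 bc.2 (j * M) =
        block_profile s (ipoly i) (j * M)].
  pose l := [seq y.2 | y <- s & y.1 == ipoly i].
  have sumle : (sumn l <= n)%N.
    rewrite -sn primary_dimE sumnE big_map big_filter [X in (_ <= X)%N]big_seq
      big_mkcond big_seq.
    apply: leq_sum => y ys; case: ifP => // _; rewrite leq_pmull //.
    have := prime_poly_size (andP (allP gs y ys)).1.
    by case: (size _) => [|[|]].
  have ln : all (leq^~ n) l.
    apply/allP => z zl; apply: leq_trans sumle.
    by rewrite sumnE (big_rem z) //= leq_addr.
  have [b [c [bM cn E]]] := balanced_exists M_gt0 ln.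
  exists (b, c); split=> // [k|j]; first exact: leq_trans (cn k) sumle.
  by rewrite E /part_profile /block_profile big_map big_filter.
have [bc bcP] := fin_all_exists part.
have bM i k : ((bc i).1 k < M)%N by case: (bcP i).
pose f : choices :=
  [ffun x : prime_index * 'I_n => (Ordinal (bM x.1 x.2),
    inord ((bc x.1).2 x.2))].
exists f => phi j Pphi.
have [[i iE]|nophi] : (exists i, ipoly i = phi) \/ ~ (exists i, ipoly i = phi).
- have [/codomP[i ->]|no] := boolP (phi \in codom ipoly); first by left;
  exists i.
  right.
  by case=> i iE; case/negP: no; rewrite -iE codom_f.
- rewrite -iE block_profile_choice; have [_ cn <-] := bcP i.
  apply: eq_bigr => k _; rewrite /rest_of /full_of !ffunE /= inord_val inordK
    //.
  exact: cn.
rewrite !block_profile_notin //; apply/negP => /mapP[y ys phiE]; apply: nophi.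
  have yg := allP gs y ys; rewrite phiE; apply: ipoly_surj;
    first by case/andP: yg.
    exact: (allP sX).
  have := sn; rewrite primary_dimE (big_rem y) //=; case/andP: yg => _ y0.
  rewrite phiE in Pphi; have := prime_poly_size Pphi.
  case: (size _) => [|z] // _ /= E; rewrite ltnS -E.
  by rewrite (leq_trans _ (leq_addr _ _)) // leq_pmulr.
by have /andP[_ /codomP[i iE]] := choice_blocksP ys; exists i; rewrite phiE.
Qed.

(** A choice [f] is sent to the class of the [M]-th power of its block matrix.
    By [ker_card_frob] the class of a power only depends on the profiles at the
    multiples of [M], so [choice_inj] gives injectivity and [choice_exists]
    surjectivity. *)
Lemma num_power_classesE : num_power_classes F n M =
  #|[set f : choices |
      (\sum_(x : prime_index * 'I_n) ideg x.1 * weight x.2 (f x))%N == n]|.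
Proof.
set S := [set f : choices | _].
have [X XP] : exists X : choices -> {'GL_n[F]},
    forall f, f \in S -> mxsim (GLval (X f)) (primary_mx (choice_blocks f)).
  apply: (@fin_all_exists choices (fun=> {'GL_n[F]})
    (fun f x => f \in S -> mxsim (GLval x) (primary_mx (choice_blocks f)))) =>
      f.
  case: (boolP (f \in S)) => [|_]; last by exists 1%g.
  rewrite inE -dim_choice_blocks => /eqP fn.
  by have [x sx] := exists_GL fn (choice_unit f); exists x.
pose cl f := ((X f ^+ M) ^: 'GL_n[F])%g.
have cl_inj : {in S &, injective cl}.
  move=> f g fS gS /mxsim_classP; rewrite !GLval_exp => simfg.
  have {}simfg : mxsim (primary_mx (choice_blocks f) ^+ M)
    (primary_mx (choice_blocks g) ^+ M).
    apply: mxsim_trans (mxsim_sym (mxsim_exp M (XP f fS))) _.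
    exact: mxsim_trans simfg (mxsim_exp M (XP g gS)).
  apply: choice_inj => i j; have Pi := ipoly_prime i.
  have := ker_card_mxsim (map_poly (pFrobenius_aut charM) (ipoly i) ^+ j) simfg.
  rewrite !ker_card_frob !ker_card_primary ?choice_primary //
    [(M * j)%N]mulnC => /eqP.
  rewrite eqn_exp2l ?card_finNzRing_gt1 // eqn_pmul2l; first by move/eqP.
  by have /andP[] := ideg_bound i.
rewrite -(card_in_imset cl_inj) /num_power_classes; apply: eq_card => C.
rewrite inE; apply/andP/imsetP => [[/imsetP[x _ ->] sub]|[f fS ->]].
  have /imsetP[y _ xy] := subsetP sub _ (class_refl _ x).
  have [s gs ys] := exists_primary_mx (GLval y).
  have sn : primary_dim s = n by rewrite -(mxsim_dim ys).
  have sX : all (fun z => z.1 != 'X) s.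
    by rewrite -primary_mx_unit // -ker_card_X -(ker_card_mxsim _ ys)
      ker_card_X; exact: GL_unitmx.
  (* The choice only has the profile of y at the multiples of M, which is enough
     for its power, and gives back its dimension. *)
  have [f fP] := choice_exists gs sX sn.
  have simf : mxsim (primary_mx (choice_blocks f) ^+ M) (GLval y ^+ M).
    apply: mxsim_ker_card => psi j Ppsi.
    have [phi Pphi psiE] := frob_surj charM Ppsi.
    rewrite -psiE !ker_card_frob (ker_card_mxsim _ ys) !ker_card_primary
      ?choice_primary //.
    by rewrite [(M * j)%N]mulnC fP.
  have fS : f \in S by rewrite inE -dim_choice_blocks (mxsim_dim simf).
  exists f => //; rewrite xy; apply/mxsim_classP; rewrite !GLval_exp.
  exact/mxsim_sym/(mxsim_trans (mxsim_exp M (XP f fS)) simf).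
split; first by rewrite mem_classes ?inE.
apply/subsetP => _ /imsetP[g _ ->]; apply/imsetP; exists (X f ^ g)%g;
  rewrite ?inE //.
by rewrite conjXg.
Qed.

End Classes.

Theorem theorem10p7 (M q : nat) (F : finFieldType)
    (M_prime : prime M) (q_power : exists2 a : nat, (0 < a)%N & q = (M ^ a)%N)
    (card_F : #|F| = q) :
  let u : fps int := fpsX int in
  1 + FPS (fun n => if (0 < n)%N then (num_power_classes F n M)%:R else 0) =
  \iprod_(d >= 1)
    ((\iprod_(k >= 1)
        ((1 + \sum_(1 <= j < M) u ^+ (d * (k * M - j))%N) /
         (1 - u ^+ (d * k * M)%N))) ^+ num_irreducible F d).
Proof.
move=> u; have M_gt1 := prime_gt1 M_prime.
have [a _ qE] := q_power.
have charM : M \in [pchar F].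
  by apply: (@card_finPcharP F M a) => //; rewrite card_F.
apply: fpsP => n; rewrite coefsD coefs1 /=.
transitivity ((fps_iprod (fun d => fps_iprod (factor M d) ^+ num_irreducible F
  d)) n); last by [].
case: n => [|n] /=.
  rewrite (@iprod_trunc _ _ 0 1) ?big_geq ?addr0 // => d i id.
  rewrite (@eq_uptoX _ i _ 1) ?expr1n // => j ji.
  by rewrite iprod_factor_small // (leq_ltn_trans ji).
rewrite add0r (@coef_iprod_factor _ M_gt1 _ (@ideg F n) _ n.+1).
- by rewrite (num_power_classesE n charM).
- exact: ideg_bound.
- exact: num_irreducibleE.
Qed.
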